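(* Let $F$ be a field of characteristic different from $2$ and let $\mathcal H$ be a subring of $F$ with fraction field $F$. Assume that $\mathcal H$ is square-effective and that $(1+\Sigma F)\cap\mathrm{Jac}(\mathcal H)\neq\emptyset$. Then $p(F)\leq p^*(\mathcal H)+1$.
   Context: For a commutative ring $R$ and $k\in\mathbb{N}$, $\Sigma_k R$ is the set of sums of $k$ squares in $R$, $\Sigma R=\bigcup_k\Sigma_kR$; $R^\times$ is the unit group and $\mathrm{Jac}(R)=\{x\in R\mid 1-Rx\subseteq R^\times\}$ the Jacobson radical. $p(F)=\inf\{k\mid\Sigma F=\Sigma_kF\}\in\mathbb{N}\cup\{\infty\}$. $p^*(\mathcal H)=\inf\{k\in\mathbb{N}\mid \mathcal H^\times\cap\Sigma F\subseteq\Sigma_kF\}\in\mathbb{N}\cup\{\infty\}$. $\mathcal H$ is square-effective if for all $f_1,f_2\in F$ there exist $g_1,g_2\in F$ with $f_1^2+f_2^2=g_1^2+g_2^2$ and $f_1\mathcal H+f_2\mathcal H=g_1\mathcal H\supseteq g_2\mathcal H$. *)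

(* Defs.v *)
From mathcomp Require Import all_boot all_order all_algebra.
From mathcomp Require Import boolp classical_sets.

Set Implicit Arguments.
Unset Strict Implicit.
Unset Printing Implicit Defensive.

Import Order.TTheory GRing.Theory Num.Theory.

Local Open Scope classical_set_scope.
Local Open Scope ring_scope.

(* [None] is infinity; in particular [enat_inf set0 = None]. *)
Definition enat := option nat.

Definition enat_le (m n : enat) : bool :=
  match m, n with
  | _, None => true
  | None, Some _ => false
  | Some i, Some j => (i <= j)%N
  end.

Definition enat_add (m n : enat) : enat :=
  match m, n with
  | Some i, Some j => Some (i + j)%N
  | _, _ => None
  end.

Definition enat_inf (A : set nat) : enat :=
  if pselect (exists k, `[< A k >]) is left exA then Some (ex_minn exA)
  else None.

Definition sumsq_k (R : comPzRingType) (k : nat) : set R :=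
  [set x | exists f : 'I_k -> R, x = \sum_(i < k) f i ^+ 2].
Arguments sumsq_k R k : clear implicits.

Definition sumsq (R : comPzRingType) : set R := \bigcup_k sumsq_k R k.
Arguments sumsq R : clear implicits.

Definition pythagoras_number (F : fieldType) : enat :=
  enat_inf [set k | sumsq F = sumsq_k F k].

(* The units are those of the ring [H] itself: the inverse must lie in [H]. *)
Definition subring_units (F : fieldType) (H : subringClosed F) : set F :=
  [set x | x \in H /\ exists2 y, y \in H & x * y = 1].

Definition subring_jac (F : fieldType) (H : subringClosed F) : set F :=
  [set x | x \in H /\ [set 1 - r * x | r in [set` H]] `<=` subring_units H].

Definition has_fraction_field (F : fieldType) (H : subringClosed F) : Prop :=
  forall x : F, exists a b : F, [/\ a \in H, b \in H, b != 0 & x = a / b].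

Definition pstar (F : fieldType) (H : subringClosed F) : enat :=
  enat_inf [set k | subring_units H `&` sumsq F `<=` sumsq_k F k].

Definition square_effective (F : fieldType) (H : subringClosed F) : Prop :=
  forall f1 f2 : F, exists g1 g2 : F,
    [/\ f1 ^+ 2 + f2 ^+ 2 = g1 ^+ 2 + g2 ^+ 2,
        [set f1 * a + f2 * b | a in [set` H] & b in [set` H]] =
          [set g1 * a | a in [set` H]]
      & [set g2 * a | a in [set` H]] `<=` [set g1 * a | a in [set` H]]].

(* Main.v *)
(* Let j = 1 + s lie in the Jacobson radical of H, with s a sum of squares.
   Applying square-effectiveness repeatedly, every sum of squares of F takes
   the form x = g^2 (1 + r), where r is in H and is a sum of squares.  Then
   u := j^2 (1 + r) - 1 is congruent to -1 modulo the Jacobson radical, so it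
   is a unit of H, and u = j^2 r + s^2 + 2 s is a sum of squares.  If j != 0,
   then x = (g / j)^2 (1 + u) needs at most p^*(H) + 1 squares.  If j = 0, then
   -1 is a sum of squares and a unit of H, hence a sum of p^*(H) squares, and
   x = ((x + 1) / 2)^2 + (-1) ((x - 1) / 2)^2. *)
Require Import Defs.
From mathcomp Require Import all_boot all_order all_algebra.
From mathcomp Require Import boolp classical_sets.
From mathcomp Require Import ring.

Set Implicit Arguments.
Unset Strict Implicit.
Unset Printing Implicit Defensive.

Import Order.TTheory GRing.Theory Num.Theory.

Local Open Scope classical_set_scope.
Local Open Scope ring_scope.

Lemma enat_inf_le (A : set nat) (k : nat) : A k -> enat_le (enat_inf A) (Some k).
Proof.
move=> Ak; rewrite /enat_inf; case: pselect => [exA|[]].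
  by case: ex_minnP => m _ /(_ k) /=; apply; apply/asboolP.
by exists k; apply/asboolP.
Qed.

(** A finite infimum in the naturals is attained; this turns a finite value of [pstar H] into a
    usable bound. *)
Lemma enat_inf_mem (A : set nat) (k : nat) : enat_inf A = Some k -> A k.
Proof.
rewrite /enat_inf; case: pselect => // exA.
by case: ex_minnP => m /asboolP Am _ [<-].
Qed.

Section SumsOfSquares.
Variable R : comPzRingType.

Lemma sumsq_k0 : sumsq_k R 0 0.
Proof. by exists (fun=> 0); rewrite big_ord0. Qed.

Lemma sumsq_kS (k : nat) (x : R) :
  sumsq_k R k.+1 x <-> exists a y, sumsq_k R k y /\ x = a ^+ 2 + y.
Proof.
split=> [[f ->]|[a [y [[f ->] ->]]]].
  rewrite big_ord_recl; exists (f ord0), (\sum_(i < k) f (lift ord0 i) ^+ 2).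
  by split=> //; exists (fun i => f (lift ord0 i)).
exists (fun i => if unlift ord0 i is Some j then f j else a).
rewrite big_ord_recl unlift_none; congr (_ + _).
by apply: eq_bigr => i _; rewrite liftK.
Qed.

Lemma sumsq_k_sqrM (k : nat) (a x : R) :
  sumsq_k R k x -> sumsq_k R k (a ^+ 2 * x).
Proof.
move=> [f ->]; exists (fun i => a * f i).
by rewrite mulr_sumr; apply: eq_bigr => i _; rewrite exprMn.
Qed.

Lemma sumsq_k_sub (k : nat) : sumsq_k R k `<=` sumsq R.
Proof. by move=> x xk; exists k. Qed.

Lemma sumsq0 : sumsq R 0.
Proof. by exists 0%N => //; apply: sumsq_k0. Qed.

Lemma sumsqD (x y : R) : sumsq R x -> sumsq R y -> sumsq R (x + y).
Proof.
move=> [k _ xk] [l _ yl]; exists (k + l)%N => //.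
elim: k x xk => [|k IHk] x; first by move=> [f ->]; rewrite big_ord0 add0r.
move=> /sumsq_kS[a [z [zk ->]]]; apply/sumsq_kS.
by exists a, (z + y); rewrite addrA; split=> //; apply: IHk.
Qed.

Lemma sumsq_sqr (a : R) : sumsq R (a ^+ 2).
Proof.
exists 1%N => //; apply/sumsq_kS; exists a, 0.
by rewrite addr0; split=> //; apply: sumsq_k0.
Qed.

Lemma sumsq_sqrM (a x : R) : sumsq R x -> sumsq R (a ^+ 2 * x).
Proof. by move=> [k _ /(sumsq_k_sqrM a) xk]; exists k. Qed.

End SumsOfSquares.

(** Induction on the number of squares. Replacing [g ^+ 2 + f ^+ 2] by [g1 ^+ 2 + g2 ^+ 2], where
    [g = g1 * a] and [g2 = g1 * b] with [a], [b] in [H], turns [f ^+ 2 + g ^+ 2 * (1 + r)] into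
    [g1 ^+ 2 * (1 + (b ^+ 2 + a ^+ 2 * r))]. *)
Lemma square_effective_sumsq (F : fieldType) (H : subringClosed F) (x : F) :
  square_effective H -> sumsq F x ->
  exists g r, [/\ r \in H, sumsq F r & x = g ^+ 2 * (1 + r)].
Proof.
move=> sqeffH [k _]; elim: k x => [|k IHk] x.
  move=> [f ->]; rewrite big_ord0; exists 0, 0.
  by rewrite rpred0 expr0n mul0r; split=> //; apply: sumsq0.
move=> /sumsq_kS[f [_ [/IHk[g [r [rH r_sq ->]]] ->]]].
have [g1 [g2 [e2 eI sub2]]] := sqeffH g f.
have [a aH ga] : [set g1 * a | a in [set` H]] g.
  rewrite -eI; exists 1; first exact: rpred1.
  by exists 0; rewrite ?mulr1 ?mulr0 ?addr0 //; apply: rpred0.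
have [b bH gb] : [set g1 * a | a in [set` H]] g2.
  by apply: sub2; exists 1; rewrite ?mulr1 //; apply: rpred1.
exists g1, (b ^+ 2 + a ^+ 2 * r); split.
- by rewrite rpredD ?rpredM ?rpredX.
- by apply: sumsqD; [apply: sumsq_sqr|apply: sumsq_sqrM].
- rewrite mulrDr mulr1 addrA [f ^+ 2 + _]addrC e2 -ga -gb; ring.
Qed.

Lemma subring_unitsN (F : fieldType) (H : subringClosed F) (x : F) :
  subring_units H x -> subring_units H (- x).
Proof.
move=> [xH [y yH xy1]]; split; first by rewrite rpredN.
by exists (- y); rewrite ?rpredN ?mulrNN.
Qed.

Lemma sumsq_k_of_sumsqN1 (F : fieldType) (k : nat) (x : F) :
  2%N \notin [pchar F] -> sumsq_k F k (-1) -> sumsq_k F k.+1 x.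
Proof.
(* Since [prime 2] evaluates to true, [2%N \in [pchar F]] reduces to [2%:R == 0]. *)
move=> char2 m1k; have two_neq0 : (2%:R : F) != 0 by apply: contra char2 => F2.
apply/sumsq_kS; exists ((x + 1) / 2), (((x - 1) / 2) ^+ 2 * -1).
by split; [apply: sumsq_k_sqrM|field].
Qed.

Theorem theorem2p3 (F : fieldType) (H : subringClosed F)
    (char_neq2 : 2%N \notin [pchar F])
    (fracH : has_fraction_field H)
    (sqeffH : square_effective H)
    (jacH : [set 1 + s | s in sumsq F] `&` subring_jac H !=set0) :
  enat_le (pythagoras_number F) (enat_add (pstar H) (Some 1%N)).
Proof.
(* If [pstar H] is infinite, so is the right-hand side. *)
case def_n: (pstar H) => [n|]; last by case: (pythagoras_number F).
have units_n := enat_inf_mem def_n.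
rewrite /= addn1; apply/enat_inf_le/seteqP.
split=> [x x_sq|]; last exact: sumsq_k_sub.
have [_ [[s s_sq <-] [jH jac_j]]] := jacH.
have [j0|j_neq0] := eqVneq (1 + s) 0.
  have sN1 : s = -1 by apply/eqP; rewrite -addr_eq0 addrC j0.
  apply: sumsq_k_of_sumsqN1 => //; apply: units_n.
  split; last by rewrite -sN1.
  by split; [|exists (-1)]; rewrite ?rpredN ?rpred1 ?mulrNN ?mulr1.
have [g [r [rH r_sq ->]]] := square_effective_sumsq sqeffH x_sq.
set j := 1 + s in jH jac_j j_neq0.
pose u := j ^+ 2 * (1 + r) - 1.
have u_n : sumsq_k F n u.
  apply: units_n; split.
    (* This exhibits [- u] as [1 - c * j] with [c = j * (1 + r)] in [H], the shape that [jac_j]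
       declares a unit. *)
    have -> : u = - (1 - j * (1 + r) * j) by rewrite /u; ring.
    apply/subring_unitsN/jac_j; exists (j * (1 + r)) => //=.
    by rewrite rpredM // rpredD ?rpred1.
  have -> : u = j ^+ 2 * r + (s ^+ 2 + (s + s)) by rewrite /u /j; ring.
  apply: sumsqD; first exact: sumsq_sqrM.
  by apply: sumsqD; [apply: sumsq_sqr|apply: sumsqD].
(* The term 1 of [1 + u] costs one square beyond the [n] for [u]. *)
apply/sumsq_kS; exists (g / j), ((g / j) ^+ 2 * u).
by split; [apply: sumsq_k_sqrM|rewrite /u; field].
Qed.
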